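(* Let $m$ be a positive integer and $\lambda$ a nonzero real number. For every $n\ge0$, $$D_{m,\lambda}(n+1)=\sum_{l=0}^{n}\sum_{i=0}^{l}\binom{l}{i}\binom{n}{l}(n-l)!\,(-\lambda)^{n-l}(m)_{i,\lambda}\,D_{m,\lambda}(l-i)\,(1+\delta_{0,i}),$$ where $\delta$ is the Kronecker delta.
   Context: For a nonzero real $\lambda$: $(x)_{0,\lambda}=1$, $(x)_{n,\lambda}=x(x-\lambda)\cdots(x-(n-1)\lambda)$; $(x)_n=(x)_{n,1}$. Degenerate Whitney numbers of the second kind $W_{m,\lambda}(n,k)$: $(mx+1)_{n,\lambda}=\sum_{k=0}^{n}W_{m,\lambda}(n,k)m^{k}(x)_{k}$. Degenerate Dowling numbers: $D_{m,\lambda}(n)=\sum_{k=0}^{n}W_{m,\lambda}(n,k)$. *)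

(* Defs.v *)
From mathcomp Require Import all_boot all_order all_algebra.
From mathcomp Require Import boolp classical_sets reals.
From mathcomp Require Import ring.
Set Implicit Arguments.
Unset Strict Implicit.
Unset Printing Implicit Defensive.
Import Order.TTheory GRing.Theory Num.Theory.
Local Open Scope ring_scope.

(* (x)_{n, lam} = x (x - lam) ... (x - (n - 1) lam); the ordinary falling
   factorial (x)_n is [dfall 1 x n]. *)
Definition dfall (R : realType) (lam x : R) (n : nat) : R :=
  \prod_(i < n) (x - i%:R * lam).

(* The second conjunct only normalises the entries above the diagonal, which
   the defining expansion leaves unconstrained. *)
Definition is_degWhitney (R : realType) (m : nat) (lam : R)
    (W : nat -> nat -> R) : Prop :=
  (forall (n : nat) (x : R),
     dfall lam (m%:R * x + 1) n =
     \sum_(k < n.+1) W n k * m%:R ^+ k * dfall 1 x k) /\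
  (forall n k : nat, (n < k)%N -> W n k = 0).

(* The family determined by the defining expansion: [degWhitneyP] gives its
   existence and, for 0 < m, [degWhitney_unique] its uniqueness. *)
Definition degWhitney (R : realType) (m : nat) (lam : R) : nat -> nat -> R :=
  xget (fun _ _ => 0) [set W | is_degWhitney m lam W]%classic.

Definition degDowling (R : realType) (m : nat) (lam : R) (n : nat) : R :=
  \sum_(k < n.+1) degWhitney m lam n k.

Lemma dfallS (R : realType) (lam x : R) (n : nat) :
  dfall lam x n.+1 = dfall lam x n * (x - n%:R * lam).
Proof. by rewrite /dfall big_ord_recr. Qed.

Lemma ex_degWhitney (R : realType) (m : nat) (lam : R) :
  exists W, is_degWhitney m lam W.
Proof.
pose W := fix W (n k : nat) {struct n} : R :=
  if n is n'.+1 then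
    (if k is k'.+1 then W n' k' else 0)
    + (m%:R * k%:R + 1 - n'%:R * lam) * W n' k
  else (k == 0%N)%:R.
have W0 : forall n k, (n < k)%N -> W n k = 0.
  elim=> [|n IH] [|k] //= nk.
  by rewrite IH // IH ?mulr0 ?addr0 // ltnW.
exists W; split=> // n x; elim: n => [|n IH].
  by rewrite big_ord1 /dfall !big_ord0 /= !mulr1.
pose A k := (if k is k'.+1 then W n k' else 0) * m%:R ^+ k * dfall 1 x k.
pose G k := (m%:R * k%:R + 1 - n%:R * lam) * W n k * m%:R ^+ k * dfall 1 x k.
transitivity (\sum_(k < n.+2) A k + \sum_(k < n.+2) G k); last first.
  by rewrite -big_split; apply: eq_bigr => k _; rewrite /A /G /= !mulrDl.
rewrite big_ord_recl [X in _ = _ + X]big_ord_recr /= {1}/A {2}/G W0 //.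
rewrite mulr0 !mul0r add0r addr0 -big_split /= dfallS IH mulr_suml.
by apply: eq_bigr => k _; rewrite /A /G /bump /= add1n dfallS exprS; ring.
Qed.

Lemma degWhitneyP (R : realType) (m : nat) (lam : R) :
  is_degWhitney m lam (degWhitney m lam).
Proof.
have [W HW] := ex_degWhitney m lam.
exact: (@xgetPex _ (fun _ _ => 0)
  [set W | is_degWhitney m lam W]%classic (ex_intro _ W HW)).
Qed.

Lemma degWhitney_unique (R : realType) (m : nat) (lam : R)
    (W : nat -> nat -> R) :
  (0 < m)%N -> is_degWhitney m lam W -> forall n k, W n k = degWhitney m lam n k.
Proof.
move=> m0 [HW HW0] n k; have [HV HV0] := degWhitneyP m lam.
set V := degWhitney m lam in HV HV0 *.
have [nk|kn] := ltnP n k; first by rewrite HW0 ?HV0.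
have fall0 (a b : nat) : (a < b)%N -> dfall 1 (a%:R : R) b = 0.
  move=> ab; rewrite /dfall (bigD1 (Ordinal ab)) //=.
  by rewrite mulr1 subrr mul0r.
have fallN0 (a : nat) : dfall 1 (a%:R : R) a != 0.
  rewrite /dfall; apply/prodf_neq0 => i _.
  by rewrite mulr1 subr_eq0 eqr_nat gtn_eqF.
have mN0 : m%:R != 0 :> R by rewrite pnatr_eq0 -lt0n.
elim/ltn_ind: k kn => k IH kn.
have kn' : (k < n.+1)%N by [].
have := HW n k%:R; rewrite HV (bigD1 (Ordinal kn')) //=.
rewrite [in RHS](bigD1 (Ordinal kn')) //=.
rewrite [X in _ + X = _](_ : _ = \sum_(i < n.+1 | i != Ordinal kn')
    W n i * m%:R ^+ i * dfall 1 k%:R i); last first.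
  apply: eq_bigr => i; rewrite -val_eqE /= => ik.
  have [ltik|leki] := ltnP i k; first by rewrite IH // -ltnS.
  by rewrite fall0 ?mulr0 // ltn_neqAle eq_sym ik.
move/addIr/(mulIf (fallN0 k)).
by move/(mulIf (expf_neq0 k mN0)).
Qed.

(* Main.v *)
(** With [L] the linear functional on polynomials such that
    [L (m ^ k (x)_k) = 1] for all [k] (expectation under the Poisson law of
    mean [1 / m]), [D n = L ((m x + 1)_(n, lam))].  Since
    [x (x - 1)_k = (x)_(k + 1)], [L (m x p(x)) = L (p(x + 1))]; for
    [p(x) = (m x + 1)_(n, lam)] the right-hand side is expanded by the
    Vandermonde convolution of [(m x + 1) + m].  This gives
      [D (n + 1) + n lam D n = D n + \sum_i 'C(n, i) (m)_(i, lam) D (n - i)],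
    and unrolling this first-order recurrence in [n] produces the factors
    ['C(n, l) (n - l)! (- lam) ^ (n - l)]. *)
Require Import Defs.
From mathcomp Require Import all_boot all_order all_algebra.
From mathcomp Require Import reals.
From mathcomp Require Import ring.
Import Order.TTheory GRing.Theory Num.Theory.
Local Open Scope ring_scope.

Lemma dfall0 (R : realType) (lam x : R) : dfall lam x 0 = 1.
Proof. by rewrite /dfall big_ord0. Qed.

Lemma dfall1_recl (R : realType) (x : R) (n : nat) :
  dfall 1 x n.+1 = x * dfall 1 (x - 1) n.
Proof.
rewrite /dfall big_ord_recl mul0r subr0; congr (_ * _).
by apply: eq_bigr => i _; rewrite /= /bump add1n -natr1; ring.
Qed.

(** Splitting [x + y - n lam] as [(x - i lam) + (y - (n - i) lam)] raises one of the two indices in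
    each term; Pascal's rule then merges the two sums. *)
Lemma dfall_Vandermonde (R : realType) (lam x y : R) (n : nat) :
  dfall lam (x + y) n =
  \sum_(i < n.+1) 'C(n, i)%:R * dfall lam x i * dfall lam y (n - i).
Proof.
elim: n => [|n IHn]; first by rewrite big_ord1 !dfall0 bin0 !mulr1.
pose t (i j : nat) := dfall lam x i * dfall lam y j.
transitivity (\sum_(i < n.+1) 'C(n, i)%:R * t i.+1 (n - i)%N
    + \sum_(i < n.+1) 'C(n, i)%:R * t i (n - i).+1).
  rewrite dfallS IHn mulr_suml -big_split; apply: eq_bigr => i _.
  have lein : (i <= n)%N by rewrite -ltnS.
  by rewrite /t !dfallS natrB //=; ring.
rewrite [X in _ + X]big_ord_recl [RHS]big_ord_recl /= !bin0 !subn0 addrCA.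
congr (_ + _); first by rewrite /t mulrA.
rewrite [X in _ + X](_ : _ = \sum_(i < n.+1) 'C(n, i.+1)%:R * t i.+1 (n - i)%N).
  rewrite -big_split; apply: eq_bigr => i _ /=.
  by rewrite /t /bump add1n binS subSS natrD; ring.
rewrite [RHS]big_ord_recr /= bin_small // mul0r addr0.
by apply: eq_bigr => i _; rewrite /bump add1n subnSK.
Qed.

(** Evaluation at [x = k] kills the terms above [k], induction kills those below, and [dfall 1 k k]
    is nonzero. *)
Lemma dfall1_free (R : realType) (N : nat) (c : nat -> R) :
  (forall x, \sum_(k < N) c k * dfall 1 x k = 0) ->
  forall k, (k < N)%N -> c k = 0.
Proof.
move=> c0; elim/ltn_ind => k IHk kN.
have fall0 (j : nat) : (k < j)%N -> dfall 1 (k%:R : R) j = 0.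
  by move=> kj; rewrite /dfall (bigD1 (Ordinal kj)) //= mulr1 subrr mul0r.
have fallN0 : dfall 1 (k%:R : R) k != 0.
  by apply/prodf_neq0 => i _; rewrite mulr1 subr_eq0 eqr_nat gtn_eqF.
have := c0 k%:R; rewrite (bigD1 (Ordinal kN)) //= big1 ?addr0.
  by move/eqP; rewrite mulf_eq0 (negPf fallN0) orbF => /eqP.
move=> i; rewrite -val_eqE /= neq_ltn => /orP[ltik|ltki].
  by rewrite IHk ?mul0r.
by rewrite fall0 ?mulr0.
Qed.

Lemma sum_degWhitney_widen (R : realType) (m : nat) (lam : R) (F : nat -> R)
    (n N : nat) : (n < N)%N ->
  \sum_(k < n.+1) degWhitney m lam n k * F k =
  \sum_(k < N) degWhitney m lam n k * F k.
Proof.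
move=> nN; have [_ W0] := degWhitneyP m lam.
rewrite (big_ord_widen N (fun k => degWhitney m lam n k * F k)) //.
rewrite big_mkcond; apply: eq_bigr => k _.
by case: ltnP => // nk; rewrite W0 ?mul0r.
Qed.

Lemma degDowling_widen (R : realType) (m : nat) (lam : R) (n N : nat) :
  (n < N)%N -> degDowling m lam n = \sum_(k < N) degWhitney m lam n k.
Proof.
move=> nN; have := sum_degWhitney_widen R m lam (fun=> 1) n N nN.
by under eq_bigr do rewrite mulr1; under [RHS]eq_bigr do rewrite mulr1.
Qed.

Lemma dfall_degWhitney (R : realType) (m : nat) (lam x : R) (n N : nat) :
  (n < N)%N ->
  dfall lam (m%:R * x + 1) n =
  \sum_(k < N) degWhitney m lam n k * (m%:R ^+ k * dfall 1 x k).
Proof.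
move=> nN; have [WE _] := degWhitneyP m lam.
rewrite -(sum_degWhitney_widen R m lam (fun k => m%:R ^+ k * dfall 1 x k) n) //.
by rewrite WE; apply: eq_bigr => k _; rewrite mulrA.
Qed.

(* The coefficients of [(m (x + 1) + 1)_(n, lam)] in the basis [m ^ k (x)_k]. *)
Definition shift_coef (R : realType) (m : nat) (lam : R) (n k : nat) : R :=
  \sum_(i < n.+1) 'C(n, i)%:R * dfall lam m%:R i * degWhitney m lam (n - i) k.

(** The basis is taken at [x - 1] so that a later factor [x] turns [dfall 1 (x - 1) k] into
    [dfall 1 x k.+1]. *)
Lemma dfall_shift_coef (R : realType) (m : nat) (lam x : R) (n : nat) :
  dfall lam (m%:R * x + 1) n =
  \sum_(k < n.+1) shift_coef R m lam n k * (m%:R ^+ k * dfall 1 (x - 1) k).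
Proof.
have -> : m%:R * x + 1 = m%:R + (m%:R * (x - 1) + 1) by ring.
rewrite dfall_Vandermonde; under [RHS]eq_bigr do rewrite mulr_suml.
rewrite exchange_big; apply: eq_bigr => i _ /=.
rewrite (@dfall_degWhitney _ _ _ _ _ n.+1) ?ltnS ?leq_subr // mulr_sumr.
by apply: eq_bigr => k _; rewrite mulrA.
Qed.

(** Coefficient comparison after writing the last factor [m x + 1 - n lam] as [(1 - n lam) + m x]:
    multiplication by [m x] shifts the index of [shift_coef] by one. *)
Lemma degWhitneyS_shift_coef (R : realType) (m : nat) (lam : R) (n k : nat) :
  (0 < m)%N -> (k < n.+2)%N ->
  degWhitney m lam n.+1 k = (1 - n%:R * lam) * degWhitney m lam n k
    + (if k is k'.+1 then shift_coef R m lam n k' else 0).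
Proof.
move=> m0 kn; set W := degWhitney m lam.
pose b k := if k is k'.+1 then shift_coef R m lam n k' else 0.
pose d k := W n.+1 k - ((1 - n%:R * lam) * W n k + b k).
suff : d k * m%:R ^+ k = 0.
  move/eqP; rewrite mulf_eq0 expf_eq0 pnatr_eq0 (gtn_eqF m0) andbF orbF.
  by rewrite subr_eq0 => /eqP.
apply: (dfall1_free R n.+2 (fun k => d k * m%:R ^+ k)) kn => x.
transitivity (dfall lam (m%:R * x + 1) n.+1
    - ((1 - n%:R * lam) * dfall lam (m%:R * x + 1) n
       + m%:R * x * dfall lam (m%:R * x + 1) n)); last by rewrite dfallS; ring.
rewrite (@dfall_degWhitney _ _ _ _ n.+1 n.+2) //.
(* Only the copy multiplied by [1 - n lam] is expanded here; the one multiplied by [m x] is kept for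
   the expansion at [x - 1]. *)
rewrite {1}(@dfall_degWhitney _ _ _ _ n n.+2) //.
rewrite dfall_shift_coef.
have -> : m%:R * x * (\sum_(k < n.+1) shift_coef R m lam n k *
      (m%:R ^+ k * dfall 1 (x - 1) k)) =
    \sum_(k < n.+2) b k * (m%:R ^+ k * dfall 1 x k).
  rewrite [RHS]big_ord_recl /= mul0r add0r mulr_sumr.
  by apply: eq_bigr => i _; rewrite /bump add1n dfall1_recl exprS /=; ring.
rewrite mulr_sumr -big_split -sumrB; apply: eq_bigr => i _ /=.
by rewrite /d /W; ring.
Qed.

Lemma degDowlingS (R : realType) (m : nat) (lam : R) (n : nat) : (0 < m)%N ->
  degDowling m lam n.+1 = (1 - n%:R * lam) * degDowling m lam n
    + \sum_(i < n.+1) 'C(n, i)%:R * dfall lam m%:R i * degDowling m lam (n - i).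
Proof.
move=> m0; rewrite {1}/degDowling.
under eq_bigr => k _ do rewrite degWhitneyS_shift_coef //.
rewrite big_split -mulr_sumr /= -degDowling_widen //; congr (_ + _).
rewrite big_ord_recl /= add0r exchange_big; apply: eq_bigr => i _ /=.
by rewrite -mulr_sumr -degDowling_widen // ltnS leq_subr.
Qed.

(** This is the unrolled form of the recurrence [S (n + 1) = s (n + 1) + (n + 1) a S n], to be used
    with [a = - lam] and [S n = D (n + 1)]. *)
Lemma sum_bin_fact_rec (R : comPzRingType) (a : R) (s : nat -> R) (n : nat) :
  \sum_(l < n.+2) 'C(n.+1, l)%:R * ((n.+1 - l)`!)%:R * a ^+ (n.+1 - l) * s l =
  s n.+1 + n.+1%:R * a *
    \sum_(l < n.+1) 'C(n, l)%:R * ((n - l)`!)%:R * a ^+ (n - l) * s l.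
Proof.
rewrite big_ord_recr /= binn subnn fact0 expr0 !mul1r addrC mulr_sumr.
congr (_ + _); apply: eq_bigr => l _.
have ln : (l <= n)%N by rewrite -ltnS.
rewrite subSn // exprS factS natrM.
have -> : 'C(n.+1, l)%:R * ((n - l).+1%:R * (n - l)`!%:R) =
    n.+1%:R * 'C(n, l)%:R * (n - l)`!%:R :> R.
  by rewrite mulrA -!natrM (mul_bin_down n.+1 l) subSn // [('C(_, _) * _)%N]mulnC.
ring.
Qed.

Theorem theorem17 (R : realType) (m : nat) (lam : R)
    (hm : (0 < m)%N) (hlam : lam != 0) (n : nat) :
  degDowling m lam n.+1 =
  \sum_(l < n.+1) \sum_(i < l.+1)
    'C(l, i)%:R * 'C(n, l)%:R * ((n - l)`!)%:R * (- lam) ^+ (n - l)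
    * dfall lam m%:R i * degDowling m lam (l - i) * (1 + (0%N == i)%:R).
Proof.
pose D := degDowling m lam.
(* The separate [D l] equals the term [i = 0] of the sum; this doubling is what the Kronecker delta
   records. *)
pose s l := D l + \sum_(i < l.+1) 'C(l, i)%:R * dfall lam m%:R i * D (l - i)%N.
transitivity (\sum_(l < n.+1)
    'C(n, l)%:R * ((n - l)`!)%:R * (- lam) ^+ (n - l) * s l); last first.
  apply: eq_bigr => l _.
  have -> : s l = \sum_(i < l.+1) 'C(l, i)%:R * dfall lam m%:R i * D (l - i)%N
      * (1 + (0%N == i)%:R).
    rewrite /s !big_ord_recl /= bin0 dfall0 subn0 addrA !mul1r.
    congr (_ + _); first by rewrite mulrDr mulr1.
    by apply: eq_bigr => i _; rewrite addr0 mulr1.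
  by rewrite mulr_sumr; apply: eq_bigr => i _; rewrite /D; ring.
have DS k : D k.+1 = s k - k%:R * lam * D k by rewrite /D degDowlingS // /s /D; ring.
rewrite -/(D n.+1); elim: n => [|n IHn].
  by rewrite DS big_ord1 bin0 fact0 expr0 !mul1r mul0r mul0r subr0.
by rewrite sum_bin_fact_rec -IHn DS; ring.
Qed.
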